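(* Let $m$ be an odd positive integer. Then for every integer $n\ge 1$, $$\sum_{0\le k<n}F_{mk}^2=\frac{F_{mn}\,F_{m(n-1)}}{L_m}.$$
   Context: $F_n$ denotes the Fibonacci numbers: $F_0=0$, $F_1=1$, $F_n=F_{n-1}+F_{n-2}$. $L_n$ denotes the Lucas numbers: $L_0=2$, $L_1=1$, $L_n=L_{n-1}+L_{n-2}$. *)

(* Defs.v *)
From mathcomp Require Export all_boot all_order all_algebra.

Set Implicit Arguments.
Unset Strict Implicit.
Unset Printing Implicit Defensive.

Fixpoint fib (n : nat) : nat :=
  match n with
  | 0 => 0
  | p.+1 => match p with
            | 0 => 1
            | q.+1 => fib p + fib q
            end
  end.

Fixpoint lucas (n : nat) : nat :=
  match n with
  | 0 => 2
  | p.+1 => match p with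
            | 0 => 1
            | q.+1 => lucas p + lucas q
            end
  end.

Lemma fib_rec n : fib n.+2 = fib n.+1 + fib n.
Proof. by []. Qed.

Lemma lucas_rec n : lucas n.+2 = lucas n.+1 + lucas n.
Proof. by []. Qed.

(* Never 0, so dividing by a Lucas number in [rat] is genuine division. *)
Lemma lucas_gt0 n : 0 < lucas n.
Proof.
suff: (0 < lucas n) && (0 < lucas n.+1) by case/andP.
elim: n => // n /andP[h1 h2].
by rewrite h2 lucas_rec addn_gt0 h2.
Qed.

(* Main.v *)
(* For odd m the sequence k |-> F_{mk} satisfies the three-term recurrence
   F_{m(k+2)} = L_m F_{m(k+1)} + F_{mk}.  Multiplying it by F_{m(k+1)} gives
   L_m F_{m(k+1)}^2 = F_{m(k+2)} F_{m(k+1)} - F_{m(k+1)} F_{mk},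
   so the sum telescopes. *)
Require Import Defs.
From mathcomp Require Import all_boot all_order all_algebra.
From mathcomp Require Import ring.

Import GRing.Theory.
Local Open Scope ring_scope.

Lemma fib_add a b :
  fib (a + b).+1 = (fib a.+1 * fib b.+1 + fib a * fib b)%N.
Proof.
elim: a b => [|a IHa] b; first by rewrite mul1n addn0.
by rewrite addSnnS IHa !fib_rec; ring.
Qed.

(** Eliminates L_n in favour of Fibonacci numbers; the additive form avoids truncated
    subtraction. *)
Lemma lucasE n : (lucas n + fib n = 2 * fib n.+1)%N.
Proof.
suff [] : (lucas n + fib n = 2 * fib n.+1)%N
  /\ (lucas n.+1 + fib n.+1 = 2 * fib n.+2)%N by [].
elim: n => // n [IH1 IH2]; split=> //.
by rewrite lucas_rec (fib_rec n) addnACA IH1 IH2 -mulnDr.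
Qed.

(** Cassini's identity with F_{n-1} written as F_{n+1} - F_n; the quadratic form changes sign when n
    grows by one. *)
Lemma fib_cassini (R : comPzRingType) n :
  (fib n.+1)%:R ^+ 2 - (fib n.+1)%:R * (fib n)%:R - (fib n)%:R ^+ 2
    = (-1) ^+ n :> R.
Proof.
elim: n => [|n IHn]; first by rewrite /=; ring.
by rewrite [RHS]exprS -IHn fib_rec natrD; ring.
Qed.

(** In F_{a+2m} - L_m F_{a+m}, expanded over F_a and F_{a+1}, the F_{a+1} terms cancel and F_a keeps
    minus the Cassini form of m. *)
Lemma fib_lucas_rec (R : comPzRingType) m a :
  (fib (a + m + m))%:R
    = (lucas m)%:R * (fib (a + m))%:R - (-1) ^+ m * (fib a)%:R :> R.
Proof.
have lucasR : (lucas m)%:R = 2 * (fib m.+1)%:R - (fib m)%:R :> R.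
  by apply/eqP; rewrite eq_sym subr_eq -natrD lucasE natrM.
have addR b : (fib (b + m))%:R = (fib b.+1)%:R * (fib m)%:R
    + (fib b)%:R * ((fib m.+1)%:R - (fib m)%:R) :> R.
  (* F_{b+m} is F_{b+m+2} - F_{b+m+1}, so no index m-1 occurs. *)
  have := congr1 (GRing.natmul (1 : R)) (fib_add b.+1 m).
  rewrite addSn fib_rec fib_add fib_rec !(natrD, natrM).
  by move=> /(canRL (addKr _)) ->; ring.
rewrite addR fib_add addR lucasR -fib_cassini natrD !natrM; ring.
Qed.

Theorem proposition3 (m : nat) (hm0 : (0 < m)%N) (hm : odd m)
    (n : nat) (hn : (1 <= n)%N) :
  \sum_(0 <= k < n) ((fib (m * k))%:R : rat) ^+ 2
    = (fib (m * n))%:R * (fib (m * (n - 1)))%:R / (lucas m)%:R.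
Proof.
have lucas_neq0 : (lucas m)%:R != 0 :> rat.
  by rewrite Num.Theory.pnatr_eq0 -lt0n lucas_gt0.
case: n hn => // n _; rewrite subn1 /=.
elim: n => [|n IHn]; first by rewrite big_nat1 muln0 mulr0 mul0r expr0n.
have step : (fib (m * n.+2))%:R
    = (lucas m)%:R * (fib (m * n.+1))%:R + (fib (m * n))%:R :> rat.
  have := fib_lucas_rec rat m (m * n).
  (* Oddness of m turns -(-1)^m into +1. *)
  by rewrite -!mulnSr -signr_odd hm mulN1r opprK.
by rewrite big_nat_recr //= IHn step; field.
Qed.
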